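(* Fix $\eta>0$. For any $\ell\ge1$ there is an $\epsilon(\ell)>0$ such that for any mollified Coulomb potential on $T^3=\mathbb{R}^3/\mathbb{Z}^3$ with parameters $\epsilon,\eta$ and $0<\epsilon\le\epsilon(\ell)$, the following holds: if for each $N\ge1$, $S_N$ is an $N$-point configuration on $T^3$ that globally minimizes $$\mathcal{H}(x_1,\dots,x_N)=\sum_{n=1}^{\ell}h_{\epsilon,\eta}(r_n)\,|\varphi_n(x_1)+\cdots+\varphi_n(x_N)|^2$$ over all $(x_1,\dots,x_N)\in(T^3)^N$, then the sequence $\{S_N\}$ is approximately equidistributed to level $\ell$.
   Context: Mollified Coulomb potential with parameters $\epsilon,\eta>0$: the radial function $\chi(\rho)\rho^{-1}e^{-\eta\rho}$ on $\mathbb{R}^3$ ($\rho=|x|$), where $\chi\le1$ is a non-decreasing radial $C^\infty$ function with $\chi(\rho)=0$ for $0\le\rho\le\epsilon/2$ and $\chi(\rho)=1$ for $\rho\ge\epsilon$. Its Fourier transform, with the normalization $\int_{\mathbb{R}^3}\chi(|x|)|x|^{-1}e^{-\eta|x|}e^{-i(x,y)}\,dx$, is radial, and its value at $|y|=r>0$ is denoted $$h_{\epsilon,\eta}(r)=\frac{4\pi}{r}\int_0^\infty\chi(\rho)e^{-\eta\rho}\sin(r\rho)\,d\rho .$$ The non-constant Laplace eigenfunctions on $T^3$ are enumerated as $\varphi_n(x)=e^{2\pi i(\nu_n,x)}$, $n=1,2,\dots$, where $\nu_1,\nu_2,\dots$ is a fixed enumeration of the non-zero elements of $\mathbb{Z}^3$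 with $|\nu_n|$ non-decreasing, and $r_n=2\pi|\nu_n|$ (so the Laplace eigenvalue of $\varphi_n$ is $r_n^2$). An $N$-point configuration is an $N$-tuple of points of $T^3$, considered up to order and counted with multiplicity. A sequence $\{S_N\}$ of $N$-point configurations is approximately equidistributed to level $\ell$ if it asymptotically integrates all eigenfunctions up to and including level $\ell$, i.e. $\frac1N\sum_{x\in S_N}\varphi_j(x)\to\int_{T^3}\varphi_j(x)\,dx=0$ as $N\to\infty$ for every $j=1,\dots,\ell$. *)

(* Defs.v *)
From HB Require Import structures.
From mathcomp Require Import all_boot all_order all_algebra.
From mathcomp Require Import generic_quotient.
From mathcomp Require Import all_classical all_reals all_analysis.
From mathcomp Require Import complex.

Set Implicit Arguments.
Unset Strict Implicit.
Unset Printing Implicit Defensive.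

Import Order.TTheory GRing.Theory Num.Theory.
Import numFieldNormedType.Exports.

Local Open Scope classical_set_scope.
Local Open Scope ring_scope.
Local Open Scope complex_scope.
Local Open Scope quotient_scope.

Section Torus.
Variable R : realType.

Definition torus_rel (x y : 'rV[R]_3) : bool :=
  [forall i, x ord0 i - y ord0 i \is a Num.int].

Lemma torus_rel_refl : reflexive torus_rel.
Proof. by move=> x; apply/forallP => i; rewrite subrr rpred0. Qed.

Lemma torus_rel_sym : symmetric torus_rel.
Proof.
by move=> x y; apply: eq_forallb => i; rewrite -opprB rpredN.
Qed.

Lemma torus_rel_trans : transitive torus_rel.
Proof.
move=> y x z /forallP xy /forallP yz; apply/forallP => i.
by rewrite -(subrKA (y ord0 i)) rpredD.
Qed.

Canonical torus_equiv : equiv_rel 'rV[R]_3 :=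
  EquivRel torus_rel torus_rel_refl torus_rel_sym torus_rel_trans.

Definition torus : Type := {eq_quot torus_equiv}.

(* e^{it} *)
Definition expi (t : R) : R[i] := cos t +i* sin t.

Definition dotZ (k : 'rV[int]_3) (x : 'rV[R]_3) : R :=
  \sum_(i < 3) (k ord0 i)%:~R * x ord0 i.

Definition char_R3 (k : 'rV[int]_3) (x : 'rV[R]_3) : R[i] :=
  expi (2 * pi * dotZ k x).

(* [torus_char_pi] below: this does not depend on the choice of [repr x] *)
Definition torus_char (k : 'rV[int]_3) (x : torus) : R[i] :=
  char_R3 k (repr x).

Lemma expi_int (t : R) (m : int) : expi (t + 2 * pi * m%:~R) = expi t.
Proof.
have nat_per n s : expi (s + 2 * pi * n%:R) = expi s.
  elim: n s => [|n IHn] s; first by rewrite mulr0 addr0.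
  rewrite -[n.+1%:R]natr1 mulrDr mulr1 addrA -{}[RHS]IHn /expi.
  by rewrite mulr_natl cosD2pi sinD2pi.
case: m => n; first exact: nat_per.
rewrite NegzE mulrNz mulrN -[in RHS](subrK (2 * pi * n.+1%:R) t).
exact/esym/nat_per.
Qed.

Lemma torus_char_pi k x : torus_char k (\pi_torus x) = char_R3 k x.
Proof.
have /eqP : repr (\pi_torus x) = x %[mod torus] by rewrite reprK.
rewrite /torus eqmodE /= => /forallP xy.
rewrite /torus_char /char_R3.
have /intrP[m] : dotZ k (repr (\pi_torus x)) - dotZ k x \is a Num.int.
  rewrite /dotZ -sumrB; apply: rpred_sum => i _.
  by rewrite -mulrBr rpredM ?intr_int.
move/eqP; rewrite subr_eq addrC => /eqP ->.
by rewrite mulrDr expi_int.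
Qed.

(* The Lebesgue integral over the fundamental domain [0,1]^3, iterated, and
   taken separately on real and imaginary parts. *)
Definition torus_pt (a b c : R) : torus :=
  \pi_torus (\row_(i < 3) [:: a; b; c]`_i).

Definition cube_int (f : R -> R -> R -> R) : R :=
  \int[lebesgue_measure]_(a in `[0, 1])
    \int[lebesgue_measure]_(b in `[0, 1])
      \int[lebesgue_measure]_(c in `[0, 1]) f a b c.

Definition torus_int (f : torus -> R[i]) : R[i] :=
  cube_int (fun a b c => complex.Re (f (torus_pt a b c))) +i*
  cube_int (fun a b c => complex.Im (f (torus_pt a b c))).

End Torus.

Section Energy.
Variable R : realType.

Definition enorm (k : 'rV[int]_3) : R :=
  Num.sqrt (\sum_(i < 3) (k ord0 i)%:~R ^+ 2).

(* Indices start at 1; the value [nu 0] is irrelevant. *)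
Definition eigen_enum (nu : nat -> 'rV[int]_3) : Prop :=
  [/\ forall n, (0 < n)%N -> nu n != 0,
      forall m n, (0 < m)%N -> (0 < n)%N -> nu m = nu n -> m = n,
      forall k, k != 0 -> exists2 n, (0 < n)%N & nu n = k
    & forall m n, (0 < m)%N -> (m <= n)%N -> enorm (nu m) <= enorm (nu n)].

(* Only the values of [chi] on [0, +oo[ matter. As [chi] vanishes near 0, the
   radial function chi(|x|) is smooth on R^3 iff [chi] is smooth on ]0, +oo[. *)
Definition mollifier (eps : R) (chi : R -> R) : Prop :=
  [/\ forall (n : nat) (rho : R), 0 < rho -> derivable (derive1n n chi) rho 1,
      forall rho rho' : R, 0 <= rho -> rho <= rho' -> chi rho <= chi rho',
      forall rho : R, 0 <= rho -> chi rho <= 1,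
      forall rho : R, 0 <= rho -> rho <= eps / 2 -> chi rho = 0
    & forall rho : R, eps <= rho -> chi rho = 1].

(* Value at |y| = r > 0 of the Fourier transform of the mollified Coulomb
   potential chi(|x|) |x|^-1 e^(- eta |x|), reduced to a radial integral. *)
Definition coulomb_hat (eta : R) (chi : R -> R) (r : R) : R :=
  4 * pi / r *
  \int[lebesgue_measure]_(rho in `[0, +oo[)
     (chi rho * expR (- eta * rho) * sin (r * rho)).

Definition eigen_freq (nu : nat -> 'rV[int]_3) (n : nat) : R :=
  2 * pi * enorm (nu n).

(* An [N]-point configuration is represented by an [N]-tuple; the notions below
   are invariant under permutations of the tuple. *)
Definition energy (h : R -> R) (nu : nat -> 'rV[int]_3) (ell N : nat)
    (s : N.-tuple (torus R)) : R :=
  \sum_(1 <= n < ell.+1)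
     h (eigen_freq nu n) *
     ComplexField.Normc.normc (\sum_(x <- s) torus_char (nu n) x) ^+ 2.

Definition global_minimizer (h : R -> R) (nu : nat -> 'rV[int]_3)
    (ell N : nat) (s : N.-tuple (torus R)) : Prop :=
  forall t : N.-tuple (torus R), energy h nu ell s <= energy h nu ell t.

Definition approx_equidistributed (nu : nat -> 'rV[int]_3) (ell : nat)
    (S : forall N, N.-tuple (torus R)) : Prop :=
  forall j, (1 <= j <= ell)%N ->
    (fun N : nat => N%:R^-1 * \sum_(x <- S N) torus_char (nu j) x : R[i]^o)
      @ \oo --> (torus_int (torus_char (nu j)) : R[i]^o).

End Energy.

(* Main.v *)
Require Import Defs.
From mathcomp Require Import all_boot all_order all_algebra.
From mathcomp Require Import all_classical all_reals all_analysis.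
From mathcomp Require Import measurable_realfun complex ring lra.

Set Implicit Arguments.
Unset Strict Implicit.
Unset Printing Implicit Defensive.

Import Order.TTheory GRing.Theory Num.Theory.
Import numFieldNormedType.Exports.

Local Open Scope classical_set_scope.
Local Open Scope ring_scope.

(** The energy is a sum of squared exponential sums weighted by the values
    [h (r_n)].  The argument compares the minimum with an explicit
    configuration of zero energy.

    All the weights are positive once [eps] is small.  Without mollification
    the integral defining [h (r)] is
    [\int_0^oo exp (- eta x) sin (r x) dx = r / (eta ^+ 2 + r ^+ 2)], and the
    mollifier changes the integrand only on [[0, eps]], by at most 1.  Hence
    [h (r) > 0] as soon as [eps < r / (eta ^+ 2 + r ^+ 2)]
    ([coulomb_hat_gt0]).  Only the finitely many values [r_1, ..., r_ell]
    matter, so a single [eps] serves for all of them.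

    For all large [N] some configuration has energy exactly 0.  Choose an
    integer [M] larger than the absolute values of all coordinates of
    [nu_1, ..., nu_ell] and take the [N] points [(j / N) (1, M, M ^+ 2)] with
    [j < N], equally spaced on a closed curve.  The character of frequency [k]
    takes the value [w ^+ j] at the [j]-th of them, where
    [w = exp (2 pi i m / N)] and [m = k_0 + k_1 M + k_2 M ^+ 2].  The integer
    [m] is nonzero because the coordinates of [k] behave like digits in base [M]
    ([base_digits_neq0]).  When moreover [|m| < N], [w] is a nontrivial [N]-th
    root of unity and the sum of its powers vanishes
    ([eventually_null_config]).

    Therefore a minimizer has energy at most 0 for [N] large.  The weights being
    positive, every exponential sum of the minimizer is then exactly 0
    ([energy_le0]), which is the integral of a nontrivial character over the
    torus ([torus_int_char]): the averages do not merely converge to their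
    limits but are eventually equal to them. *)

(** * Positivity of the Fourier transform *)

Section Integrals.
Variable R : realType.
Implicit Types (eta r : R) (f F b : R -> R).
Local Notation mu := (@lebesgue_measure R).

Lemma ge0_FTC2y f F (l : R) :
  (forall x : R, 0 <= x -> 0 <= f x) -> continuous f ->
  (forall x : R, is_derive x 1 F (f x)) -> F x @[x --> +oo] --> l ->
  (\int[mu]_(x in `[0%R, +oo[) (f x)%:E = (l - F 0)%:E)%E.
Proof.
move=> f0 cf dF Fl; rewrite (ge0_continuous_FTC2y f0 _ Fl) ?EFinB//.
- exact: continuous_subspaceT.
- apply/cvg_at_right_filter/differentiable_continuous/derivable1_diffP.
  by have [] := dF 0.
- by move=> x _; rewrite derive1E derive_val.
Qed.

Lemma ge0_FTC2y_integrable f F (l : R) :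
  (forall x : R, 0 <= x -> 0 <= f x) -> continuous f ->
  (forall x : R, is_derive x 1 F (f x)) -> F x @[x --> +oo] --> l ->
  mu.-integrable `[0%R, +oo[ (EFin \o f).
Proof.
move=> f0 cf dF Fl; apply/integrableP; split.
  by apply/measurable_EFinP/measurable_funTS; apply: continuous_measurable_fun.
have -> : (\int[mu]_(x in `[0%R, +oo[) `|(EFin \o f) x|
    = \int[mu]_(x in `[0%R, +oo[) (f x)%:E)%E.
  apply: eq_integral => x; rewrite inE/= in_itv/= andbT => x0.
  by rewrite ger0_norm// f0.
by rewrite (ge0_FTC2y f0 cf dF Fl) ltry.
Qed.

Lemma cvg_expR_bounded0 eta b C : 0 < eta -> (forall x, `|b x| <= C) ->
  expR (- (eta * x)) * b x @[x --> +oo] --> (0 : R).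
Proof.
move=> eta0 bC.
have eC (c : R) : c * expR (- (eta * x)) @[x --> +oo] --> (0 : R).
  rewrite -[X in _ --> X](mulr0 c); apply: cvgMr.
  apply: (@cvg_comp _ _ _ (fun x => eta * x) (fun z => expR (- z))
    _ (pinfty_nbhs R)); last exact: cvgr_expR.
  exact: gt0_cvgMry.
apply: squeeze_cvgr (eC (- C)) (eC C); apply: nearW => x.
rewrite mulNr -ler_norml normrM ger0_norm ?expR_ge0// mulrC.
by rewrite ler_wpM2r ?expR_ge0.
Qed.

Definition damped_sin_primitive eta r (x : R) :=
  expR (- (eta * x)) * - ((eta ^+ 2 + r ^+ 2)^-1 *
                        (eta * sin (r * x) + r * cos (r * x))).

Lemma damped_sin_primitive0 eta r :
  damped_sin_primitive eta r 0 = - (r / (eta ^+ 2 + r ^+ 2)).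
Proof.
rewrite /damped_sin_primitive !mulr0 oppr0 expR0 sin0 cos0 mul1r mulr0 add0r.
by rewrite mulr1 mulrC.
Qed.

Lemma continuous_damped_exp eta : continuous (fun x : R => expR (- (eta * x))).
Proof.
move=> x; apply: continuous_comp; last exact: continuous_expR.
by apply: continuousN; apply: mulrl_continuous.
Qed.

Lemma is_derive_damped_exp eta (x : R) : 0 < eta ->
  is_derive x 1 (fun x => expR (- (eta * x)) * - eta^-1) (expR (- (eta * x))).
Proof.
move=> eta0.
have dm : is_derive x 1 (fun x => - (eta * x)) (- eta).
  by apply: is_derive_eq; rewrite /GRing.scale/= mulr1.
have de := is_derive1_comp (is_derive_expR _) dm.
have := is_deriveM de (is_derive_cst (- eta^-1) x 1).
move/is_derive_eq; apply.
rewrite /GRing.scale/=; field.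
by rewrite gt_eqF.
Qed.

Lemma is_derive_damped_sin eta r (x : R) : 0 < eta ->
  is_derive x 1 (damped_sin_primitive eta r)
    (expR (- (eta * x)) * sin (r * x)).
Proof.
move=> eta0.
have dm : is_derive x 1 (fun x => - (eta * x)) (- eta).
  by apply: is_derive_eq; rewrite /GRing.scale/= mulr1.
have dr : is_derive x 1 (fun x => r * x) r.
  by apply: is_derive_eq; rewrite /GRing.scale/= mulr1.
have de := is_derive1_comp (is_derive_expR _) dm.
have ds := is_derive1_comp (is_derive_sin _) dr.
have dc := is_derive1_comp (is_derive_cos _) dr.
have D0 : eta ^+ 2 + r ^+ 2 != 0.
  by rewrite gt_eqF// ltr_wpDr ?sqr_ge0// exprn_gt0.
have eqD (e s c : R) : e * - ((eta ^+ 2 + r ^+ 2)^-1 *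
      (eta * (c * r) + r * (- s * r))) +
    - ((eta ^+ 2 + r ^+ 2)^-1 * (eta * s + r * c)) * (e * - eta) = e * s.
  by field.
have := is_deriveM de (is_deriveN (is_deriveZ (eta ^+ 2 + r ^+ 2)^-1
   (is_deriveD (is_deriveZ eta ds) (is_deriveZ r dc)))).
by move/is_derive_eq; apply; exact: eqD.
Qed.

Lemma damped_exp_integral eta : 0 < eta ->
  mu.-integrable `[0%R, +oo[ (EFin \o (fun x => expR (- (eta * x)))) /\
  \int[mu]_(x in `[0%R, +oo[) expR (- (eta * x)) = eta^-1.
Proof.
move=> eta0.
have f0 x : 0 <= x -> 0 <= expR (- (eta * x)) by rewrite expR_ge0.
have cf := @continuous_damped_exp eta.
have dF x := is_derive_damped_exp x eta0.
have Fl := @cvg_expR_bounded0 eta (cst (- eta^-1)) `|- eta^-1| eta0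
  (fun=> lexx _).
split; first exact: ge0_FTC2y_integrable f0 cf dF Fl.
rewrite /Rintegral (ge0_FTC2y f0 cf dF Fl)/=.
by rewrite mulr0 oppr0 expR0 mul1r sub0r opprK.
Qed.

(** The integrand changes sign, so the fundamental theorem of calculus is
    applied to [exp (- eta x) * (1 + sin (r x))] and the contribution of the
    exponential is subtracted again. *)
Lemma damped_sin_integral eta r : 0 < eta ->
  mu.-integrable `[0%R, +oo[
    (EFin \o (fun x => expR (- (eta * x)) * sin (r * x))) /\
  \int[mu]_(x in `[0%R, +oo[) (expR (- (eta * x)) * sin (r * x)) =
    r / (eta ^+ 2 + r ^+ 2).
Proof.
move=> eta0.
have [ie Ie] := damped_exp_integral eta0.
pose f x := expR (- (eta * x)) + expR (- (eta * x)) * sin (r * x).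
have f0 x : 0 <= x -> 0 <= f x.
  move=> _; have -> : f x = expR (- (eta * x)) * (1 + sin (r * x)).
    by rewrite /f mulrDr mulr1.
  by rewrite mulr_ge0 ?expR_ge0//; have := sin_geN1 (r * x); lra.
have ce := @continuous_damped_exp eta.
have cf : continuous f.
  move=> x; apply: cvgD; first exact: ce.
  apply: cvgM; first exact: ce.
  by apply: continuous_comp; [apply: mulrl_continuous|apply: continuous_sin].
have dF x := is_deriveD (is_derive_damped_exp x eta0)
                        (is_derive_damped_sin r x eta0).
have Fl : (fun x => expR (- (eta * x)) * - eta^-1) x +
    damped_sin_primitive eta r x @[x --> +oo] --> (0 : R).
  rewrite -[X in _ --> X](addr0 0); apply: cvgD.
    exact: (@cvg_expR_bounded0 eta (cst (- eta^-1)) `|- eta^-1|).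
  apply: (@cvg_expR_bounded0 eta _
    (`|(eta ^+ 2 + r ^+ 2)^-1| * (`|eta| + `|r|))) => // x.
  rewrite normrN normrM ler_wpM2l// (le_trans (ler_normD _ _))//.
  by rewrite lerD// normrM ler_piMr// ler_norml ?sin_geN1 ?sin_le1
    ?cos_geN1 ?cos_le1.
have fi := ge0_FTC2y_integrable f0 cf dF Fl.
have If := ge0_FTC2y f0 cf dF Fl.
have eq_sin x : expR (- (eta * x)) * sin (r * x) = f x - expR (- (eta * x)).
  by rewrite /f addrAC subrr add0r.
split.
  apply: (eq_integrable _ _ _ _ (integrableB _ fi ie)) => //.
  by move=> x _; rewrite /= eq_sin EFinB.
under eq_Rintegral do rewrite eq_sin.
rewrite RintegralB// Ie /Rintegral If/=.
rewrite !fctE damped_sin_primitive0 mulr0 oppr0 expR0 mul1r sub0r opprD !opprK.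
by rewrite addrAC subrr add0r.
Qed.

(** The integrand is at least [exp (- eta x) * sin (r x)] minus the indicator of
    [[0, eps]]: beyond [eps] the mollifier is 1, and on [[0, eps]] the discarded
    part [(1 - chi x) * exp (- eta x) * sin (r x)] is at most 1. *)
Lemma coulomb_hat_gt0 eta r eps chi : 0 < eta -> 0 < r -> 0 < eps ->
  eps < r / (eta ^+ 2 + r ^+ 2) -> mollifier eps chi ->
  0 < coulomb_hat eta chi r.
Proof.
move=> eta0 r0 eps0 eps_lt [_ chi_nd chi_le1 chi_0 chi_1].
rewrite /coulomb_hat mulr_gt0// ?divr_gt0// ?mulr_gt0 ?pi_gt0//.
have [is_ Is] := damped_sin_integral r eta0.
have [ie _] := damped_exp_integral eta0.
pose g x := chi x * expR (- eta * x) * sin (r * x).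
pose lo x := expR (- (eta * x)) * sin (r * x) - \1_`[0%R, eps] x.
have chi_ge0 x : 0 <= x -> 0 <= chi x.
  move=> x0; rewrite -(chi_0 0) ?chi_nd// divr_ge0//; exact: ltW.
have mg : measurable_fun (`[0%R, +oo[ : set R) g.
  (* [chi] is only constrained on [0, +oo[; truncating its argument makes it
     monotone on the whole line. *)
  apply: (@eq_measurable_fun _ _ _ _ _ (fun x : R =>
    chi (Num.max 0 x) * expR (- eta * x) * sin (r * x))).
    move=> x; rewrite inE/= in_itv/= andbT => x0.
    by rewrite /g max_r.
  apply: measurable_funM; first apply: measurable_funM.
  - apply: nondecreasing_measurable => // x y xy.
    have xy0 : Num.max 0 x <= Num.max 0 y.
      by rewrite ge_max !le_max lexx xy orbT.
    by apply: chi_nd => //; rewrite le_max lexx.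
  - apply: measurable_funTS; apply: continuous_measurable_fun => x.
    apply: continuous_comp; last exact: continuous_expR.
    exact: mulrl_continuous.
  - apply: measurable_funTS; apply: continuous_measurable_fun => x.
    by apply: continuous_comp; [apply: mulrl_continuous|apply: continuous_sin].
have ig : mu.-integrable `[0%R, +oo[ (EFin \o g).
  apply: le_integrable ie => //; first exact/measurable_EFinP.
  move=> x /=; rewrite in_itv/= andbT => x0; rewrite lee_fin /g mulNr.
  rewrite !normrM -mulrA mulrCA ler_piMr// mulr_ile1//.
    by rewrite ger0_norm ?chi_ge0 ?chi_le1.
  by rewrite ler_norml sin_geN1 sin_le1.
have i1 : mu.-integrable `[0%R, +oo[ (EFin \o \1_`[0%R, eps]).
  by apply: integrableS (integrable_indic_itv 0 eps true false).
have I1 : \int[mu]_(x in `[0%R, +oo[) \1_`[0%R, eps] x = eps.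
  have IE : (\int[mu]_(x in `[0%R, +oo[) (\1_`[0%R, eps] x)%:E = eps%:E)%E.
    rewrite integral_indic// setIidl; last first.
      by move=> x /=; rewrite !in_itv/= andbT => /andP[].
    apply: etrans (lebesgue_measure_itv _) _.
    by rewrite /= lte_fin eps0 oppr0 adde0.
  by rewrite /Rintegral IE.
have Ilo : \int[mu]_(x in `[0%R, +oo[) lo x = r / (eta ^+ 2 + r ^+ 2) - eps.
  by rewrite RintegralB// Is I1.
have ilo : mu.-integrable `[0%R, +oo[ (EFin \o lo).
  exact: (eq_integrable _ _ _ _ (integrableB _ is_ i1)).
rewrite (@lt_le_trans _ _ (r / (eta ^+ 2 + r ^+ 2) - eps)) ?subr_gt0//.
rewrite -Ilo; apply: le_Rintegral => // x /=; rewrite in_itv/= andbT => x0.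
rewrite /lo /g mulNr indicE.
have [xe|ex] := leP x eps; last first.
  by rewrite chi_1 ?(ltW ex)// mul1r gerBl.
rewrite mem_set/= ?in_itv/= ?x0 ?xe//.
have e1 : expR (- (eta * x)) <= 1.
  by rewrite -expR0 ler_expR oppr_le0 mulr_ge0// ltW.
have e0 := expR_gt0 (- (eta * x)).
rewrite lerBlDl -lerBlDr -mulrA -[X in X - _]mul1r -mulrBl.
apply: le_trans (ler_norm _) _.
rewrite !normrM mulr_ile1// ?mulr_ge0// ?mulr_ile1//.
- by rewrite ger0_norm ?subr_ge0 ?chi_le1// gerBl chi_ge0.
- by rewrite ger0_norm// ltW.
- by rewrite ler_norml sin_geN1 sin_le1.
Qed.

End Integrals.

(** * Configurations with vanishing exponential sums *)

Section SpreadPoints.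
Variable R : realType.
Implicit Types (k : 'rV[int]_3) (a b c s t : R).

Lemma expiD s t : expi (s + t) = expi s * expi t.
Proof.
rewrite /expi cosD sinD; apply/eqP.
by rewrite eq_complex/= !eqxx addrC eqxx.
Qed.

Lemma expi0 : expi 0 = 1 :> R[i].
Proof. by rewrite /expi cos0 sin0. Qed.

Lemma expiX t n : expi t ^+ n = expi (t * n%:R).
Proof.
elim: n => [|n IHn]; first by rewrite mulr0 expi0 expr0.
by rewrite exprS IHn -expiD -natr1 mulrDr mulr1 addrC.
Qed.

Lemma torus_char_pt k a b c : torus_char k (torus_pt a b c) =
  expi (2 * pi * ((k ord0 0)%:~R * a + (k ord0 1)%:~R * b +
                  (k ord0 2%:R)%:~R * c)).
Proof.
rewrite torus_char_pi /char_R3 /dotZ !big_ord_recl big_ord0 !mxE/= addr0 addrA.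
congr (expi (_ * (_ + (k _ _)%:~R * _ + (k _ _)%:~R * _))); exact: val_inj.
Qed.

(** By the double angle formula [cos (2 t) = 1 - 2 sin t ^+ 2], with
    [t = pi |m| / N] strictly between 0 and [pi]. *)
Lemma expi_frac_neq1 (m : int) (N : nat) : m != 0 -> (absz m < N)%N ->
  expi (2 * pi * (m%:~R / N%:R)) != 1 :> R[i].
Proof.
move=> m0 mN.
have N_gt0 : (0 < N)%N by exact: leq_ltn_trans mN.
have N0 : 0 < N%:R :> R by rewrite ltr0n.
apply/eqP => /(congr1 (@complex.Re R)) /= cos1.
pose t : R := pi * ((absz m)%:R / N%:R).
have t0 : 0 < sin t.
  rewrite sin_gt0_pi// mulr_gt0 ?pi_gt0 ?divr_gt0 ?ltr0n ?absz_gt0//=.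
  by rewrite -[ltRHS]mulr1 ltr_pM2l ?pi_gt0// ltr_pdivrMr// mul1r ltr_nat.
have cost : cos (2 * pi * (m%:~R / N%:R)) = cos (t *+ 2) :> R.
  have [m_ge0|m_lt0] := leP 0 m.
    by rewrite /t natr_absz ger0_norm//; congr cos; ring.
  by rewrite -cosN /t natr_absz ltr0_norm// mulrNz; congr cos; ring.
have : cos (t *+ 2) = 1 by rewrite -cost.
rewrite cos_mulr2n cos2sin2.
have : 0 < sin t ^+ 2 by rewrite exprn_gt0.
lra.
Qed.

Lemma sum_expi_eq0 (m : int) (N : nat) : m != 0 -> (absz m < N)%N ->
  \sum_(j < N) expi (2 * pi * (m%:~R / N%:R) * j%:R) = 0 :> R[i].
Proof.
move=> m0 mN; set w := 2 * pi * _.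
have N0 : N%:R != 0 :> R by rewrite pnatr_eq0 -lt0n (leq_ltn_trans _ mN).
have w1 : expi w - 1 != 0 by rewrite subr_eq0 expi_frac_neq1.
apply: (mulfI w1); rewrite mulr0.
under eq_bigr do rewrite -expiX.
rewrite -subrX1 expiX /w -mulrA divfK// -[X in expi X]add0r expi_int expi0.
by rewrite subrr.
Qed.

(** Digit by digit: [M] divides [k_0], which is smaller in absolute value, so
    [k_0 = 0]; after division by [M] the same applies to [k_1]. *)
Lemma base_digits_neq0 (k : 'rV[int]_3) (M : nat) : k != 0 ->
  (forall i, (absz (k ord0 i) < M)%N) ->
  k ord0 0 + k ord0 1 * M%:Z + k ord0 2%:R * M%:Z ^+ 2 != 0.
Proof.
move=> k0 kM; apply: contra_neq k0 => k_eq0.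
have digit (a b : int) : (absz a < M)%N -> a + M%:Z * b = 0 -> a = 0 /\ b = 0.
  move=> aM /eqP; rewrite addr_eq0 => /eqP aE.
  have b0 : b = 0.
    apply/eqP; rewrite -absz_eq0 -leqn0 leqNgt; apply/negP => b_gt0.
    by move: aM; rewrite aE abszN abszM absz_nat ltnNge leq_pmulr.
  by rewrite aE b0 mulr0 oppr0.
have [e0 r0] : k ord0 0 = 0 /\ k ord0 1 + M%:Z * k ord0 2%:R = 0.
  by apply: digit => //; rewrite -k_eq0; ring.
have [e1 e2] := digit _ _ (kM 1) r0.
apply/rowP => i; rewrite mxE.
by case: i => -[|[|[|//]]] lt_i; [rewrite -e0|rewrite -e1|rewrite -e2];
  congr (k _ _); apply: val_inj.
Qed.

(** Equally spaced points on the closed curve [t |-> t (1, M, M ^+ 2)], along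
    which the character of frequency [k] oscillates with the single frequency
    [k_0 + k_1 M + k_2 M ^+ 2]. *)
Definition spread_config (M N : nat) : N.-tuple (torus R) :=
  [tuple torus_pt (j%:R / N%:R) (M%:R * (j%:R / N%:R))
                  (M%:R ^+ 2 * (j%:R / N%:R)) | j < N].

Lemma sum_spread_config k (M N : nat) : k != 0 ->
  (forall i, (absz (k ord0 i) < M)%N) ->
  (absz (k ord0 0 + k ord0 1 * M%:Z + k ord0 2%:R * M%:Z ^+ 2)%R < N)%N ->
  \sum_(x <- spread_config M N) torus_char k x = 0.
Proof.
move=> k0 kM kN; apply: etrans (sum_expi_eq0 (base_digits_neq0 k0 kM) kN).
rewrite big_tuple; apply: eq_bigr => j _; rewrite tnth_mktuple torus_char_pt.
by congr expi; rewrite !intrD !intrM -!pmulrn; ring.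
Qed.

Lemma eventually_null_config (nu : nat -> 'rV[int]_3) (ell : nat) :
  (forall n, (0 < n)%N -> nu n != 0) ->
  exists N0, forall N, (N0 < N)%N -> exists t : N.-tuple (torus R),
    forall n, (0 < n <= ell)%N -> \sum_(x <- t) torus_char (nu n) x = 0.
Proof.
move=> nu0.
(* Sums serve as crude upper bounds for finitely many natural numbers. *)
pose M := (\sum_(n < ell.+1) \sum_(i < 3) absz (nu n ord0 i)).+1.
pose freq n := absz (nu n ord0 0 + nu n ord0 1 * M%:Z +
                     nu n ord0 2%:R * M%:Z ^+ 2)%R.
exists (\sum_(n < ell.+1) freq n) => N NN; exists (spread_config M N).
move=> n /andP[n0 n_le]; apply: sum_spread_config; first exact: nu0.
  move=> i; rewrite ltnS (bigD1 (inord n))//= (bigD1 i)//= inordK//.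
  by rewrite -addnA leq_addr.
apply: leq_ltn_trans NN; rewrite (bigD1 (inord n))//= inordK//.
exact: leq_addr.
Qed.

End SpreadPoints.

(** * Integrals of characters over the torus *)

Section CharacterIntegral.
Variable R : realType.
Implicit Types (s : R) (k : 'rV[int]_3).
Local Notation mu := (@lebesgue_measure R).

Lemma unit_itv_int_cst s : \int[mu]_(x in `[0%R, 1%R]) s = s.
Proof.
have IE : (\int[mu]_(x in `[0%R, 1%R]) s%:E = s%:E)%E.
  rewrite integral_cst//; apply: etrans (mule1 _); congr mule.
  apply: etrans (lebesgue_measure_itv _) _.
  by rewrite /= lte_fin ltr01 oppr0 adde0.
by rewrite /Rintegral IE.
Qed.

Lemma unit_itv_int_cos s (m : int) :
  \int[mu]_(x in `[0%R, 1%R]) cos (s + 2 * pi * (m%:~R * x)) =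
  if m == 0 then cos s else 0.
Proof.
case: eqVneq => [->|m0].
  under eq_Rintegral do rewrite mul0r mulr0 addr0.
  exact: unit_itv_int_cst.
pose w : R := 2 * pi * m%:~R.
have w0 : w != 0 by rewrite !mulf_neq0 ?intr_eq0// gt_eqF// pi_gt0.
pose F (x : R) := w^-1 * sin (s + w * x).
have dF (x : R) : is_derive x 1 F (cos (s + w * x)).
  have dl : is_derive x 1 (fun x => s + w * x) w.
    have := is_deriveD (is_derive_cst s x 1) (is_deriveZ w (is_derive_id x 1)).
    by move/is_derive_eq; apply; rewrite add0r /GRing.scale/= mulr1.
  have := is_deriveZ w^-1 (is_derive1_comp (is_derive_sin _) dl).
  move/is_derive_eq; apply.
  have eqF (c : R) : w^-1 * (c * w) = c by rewrite mulrC mulfK.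
  exact: eqF.
have cl : continuous (fun x : R => s + w * x).
  by move=> x; apply: cvgD; [exact: cvg_cst|exact: mulrl_continuous].
have cF : continuous F.
  move=> x; apply: cvgMr; apply: continuous_comp; first exact: cl.
  exact: continuous_sin.
have -> : \int[mu]_(x in `[0%R, 1%R]) cos (s + 2 * pi * (m%:~R * x)) =
          \int[mu]_(x in `[0%R, 1%R]) cos (s + w * x).
  by apply: eq_Rintegral => x _; rewrite /w !mulrA.
rewrite /Rintegral (@continuous_FTC2 _ _ F _ _ ltr01).
- rewrite /= /F mulr0 addr0 mulr1.
  have : expi (s + w) = expi s by rewrite /w expi_int.
  by case=> _ ->; rewrite subrr.
- apply: continuous_subspaceT => x.
  by apply: continuous_comp; [exact: cl|exact: continuous_cos].
- split.
  + by move=> x _; have [] := dF x.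
  + exact/cvg_at_right_filter/cF.
  + exact/cvg_at_left_filter/cF.
- by move=> x _; rewrite derive1E derive_val.
Qed.

(** The phase [s] lets the same computation be used for each iterated integral
    and, with [s = - pi / 2], for the imaginary part of a character. *)
Lemma cube_int_cos k s : k != 0 ->
  cube_int (fun a b c : R => cos (s + 2 * pi * ((k ord0 0)%:~R * a +
    (k ord0 1)%:~R * b + (k ord0 2%:R)%:~R * c))) = 0.
Proof.
move=> k0; rewrite /cube_int.
under eq_Rintegral => a _.
  under eq_Rintegral => b _.
    under eq_Rintegral do rewrite mulrDr addrA.
    rewrite unit_itv_int_cos; over.
  over.
case: eqVneq => [k2|_]; last by rewrite !unit_itv_int_cst.
under eq_Rintegral => a _.
  under eq_Rintegral do rewrite mulrDr addrA.
  rewrite unit_itv_int_cos; over.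
case: eqVneq => [k1|_]; last by rewrite !unit_itv_int_cst.
rewrite unit_itv_int_cos; case: eqVneq => // k0'.
case/eqP: k0; apply/rowP => i; rewrite mxE.
by case: i => -[|[|[|//]]] lt_i; [rewrite -k0'|rewrite -k1|rewrite -k2];
  congr (k _ _); apply: val_inj.
Qed.

Lemma torus_int_char k : k != 0 -> torus_int (@torus_char R k) = 0.
Proof.
move=> k0; rewrite /torus_int.
have -> : cube_int (fun a b c : R =>
    complex.Re (torus_char k (torus_pt a b c))) = 0.
  rewrite -(cube_int_cos 0 k0); congr cube_int.
  apply/funext => a; apply/funext => b; apply/funext => c.
  by rewrite torus_char_pt add0r.
have -> : cube_int (fun a b c : R =>
    complex.Im (torus_char k (torus_pt a b c))) = 0.
  rewrite -(cube_int_cos (- (pi / 2)) k0); congr cube_int.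
  apply/funext => a; apply/funext => b; apply/funext => c.
  by rewrite torus_char_pt/= -cosBpihalf addrC.
by [].
Qed.

End CharacterIntegral.

(** * Minimizers of the energy *)

Lemma positive_lower_bound (R : realFieldType) (c : nat -> R) (ell : nat) :
  (forall n, (0 < n)%N -> 0 < c n) ->
  exists2 e, 0 < e & forall n, (0 < n <= ell)%N -> e < c n.
Proof.
move=> c0; elim: ell => [|ell [e e0 IHe]].
  by exists 1 => // n /andP[]; rewrite leqn0 lt0n => /negPf->.
have c2 : 0 < c ell.+1 / 2 by rewrite divr_gt0 ?c0.
exists (Num.min e (c ell.+1 / 2)); first by rewrite lt_min e0.
move=> n /andP[n0]; rewrite leq_eqVlt => /predU1P[->|n_le].
  by rewrite gt_min ltr_pdivrMr// ltr_pMr ?c0// ltr1n orbT.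
by rewrite gt_min IHe// n0.
Qed.

Lemma eigen_freq_gt0 (R : realType) (nu : nat -> 'rV[int]_3) n :
  nu n != 0 -> 0 < eigen_freq R nu n.
Proof.
move=> nu0; rewrite /eigen_freq !mulr_gt0 ?pi_gt0//.
rewrite /enorm sqrtr_gt0 lt_neqAle sumr_ge0 ?andbT; last first.
  by move=> i _; apply: sqr_ge0.
apply: contra_neq nu0 => /esym/eqP.
rewrite psumr_eq0 => [/allP nu_eq0|i _]; last exact: sqr_ge0.
apply/rowP => i; rewrite mxE; apply/eqP.
by have := nu_eq0 i (mem_index_enum _); rewrite sqrf_eq0 intr_eq0.
Qed.

Lemma energy_le0 (R : realType) (h : R -> R) (nu : nat -> 'rV[int]_3)
    (ell N : nat) (s : N.-tuple (torus R)) :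
  (forall n, (0 < n <= ell)%N -> 0 < h (eigen_freq R nu n)) ->
  energy h nu ell s <= 0 ->
  forall n, (0 < n <= ell)%N -> \sum_(x <- s) torus_char (nu n) x = 0.
Proof.
move=> h0 E0 n n_le.
pose F n := h (eigen_freq R nu n) *
  ComplexField.Normc.normc (\sum_(x <- s) torus_char (nu n) x) ^+ 2.
have F0 i : (0 < i < ell.+1)%N -> 0 <= F i.
  by move=> i_le; rewrite mulr_ge0 ?sqr_ge0// ltW// h0.
have : energy h nu ell s == 0.
  by rewrite eq_le E0 /energy big_nat sumr_ge0.
rewrite /energy big_nat psumr_eq0// => /allP /(_ n).
rewrite mem_index_iota ltnS n_le => /(_ isT) /=.
rewrite mulf_eq0 gt_eqF ?h0//= sqrf_eq0 => /eqP.
exact: ComplexField.Normc.eq0_normc.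
Qed.

Theorem theorem7 (R : realType) (nu : nat -> 'rV[int]_3)
    (hnu : eigen_enum R nu) (eta : R) (heta : 0 < eta)
    (ell : nat) (hell : (1 <= ell)%N) :
  exists2 eps_ell : R, 0 < eps_ell &
    forall (eps : R) (chi : R -> R),
      0 < eps -> eps <= eps_ell -> mollifier eps chi ->
      forall S : (forall N : nat, N.-tuple (torus R)),
        (forall N : nat, (1 <= N)%N ->
           global_minimizer (coulomb_hat eta chi) nu ell (S N)) ->
        approx_equidistributed nu ell S.
Proof.
have [nu0 _ _ _] := hnu.
have r0 n : (0 < n)%N -> 0 < eigen_freq R nu n.
  by move=> /nu0; exact: eigen_freq_gt0.
pose c n := eigen_freq R nu n / (eta ^+ 2 + eigen_freq R nu n ^+ 2).
have [|e e0 e_lt] := @positive_lower_bound R c ell.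
  by move=> n /r0 rn; rewrite divr_gt0// addr_gt0// exprn_gt0.
exists e => // eps chi eps0 eps_le mchi S Smin j j_le.
have h_gt0 n : (0 < n <= ell)%N -> 0 < coulomb_hat eta chi (eigen_freq R nu n).
  move=> n_le; apply: (coulomb_hat_gt0 heta _ eps0 _ mchi).
    by case/andP: n_le => /r0.
  exact: le_lt_trans eps_le (e_lt n n_le).
have [N0 nullP] := eventually_null_config R ell nu0.
rewrite torus_int_char; last by case/andP: j_le => /nu0.
apply: cvg_near_cst; exists N0.+1 => // N /= N_gt.
have [t t0] := nullP N N_gt.
have Et : energy (coulomb_hat eta chi) nu ell t = 0.
  rewrite /energy big_nat big1// => n n_le.
  by rewrite t0// ComplexField.Normc.normc0 expr0n mulr0.
have ES : energy (coulomb_hat eta chi) nu ell (S N) <= 0.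
  by rewrite -Et; apply: Smin; exact: leq_trans N_gt.
by rewrite (energy_le0 h_gt0 ES j_le) mulr0.
Qed.
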